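(* Let $K\to R$ be a homomorphism of commutative rings, and let $U$ and $V$ be two $R$-modules. Let $R\to S$ be a flat epimorphism of commutative rings and $D_R\colon U\to V$ be a $K$-linear $R$-differential operator. Then there exists a unique $K$-linear $S$-differential operator $D_S\colon\mathrm{Hom}_R(S,U)\to\mathrm{Hom}_R(S,V)$ such that $p_V\circ D_S=D_R\circ p_U$, where $p_U\colon\mathrm{Hom}_R(S,U)\to U$ and $p_V\colon\mathrm{Hom}_R(S,V)\to V$ are the natural maps $g\mapsto g(1)$.
   Context: For a homomorphism of commutative rings $K\to R$ and $R$-modules $U$, $V$, the group $E=\mathrm{Hom}_K(U,V)$ is an $R$-$R$-bimodule: $(re)(u)=r\,e(u)$, $(er)(u)=e(ru)$. For $r\in R$ put $\theta_r(e)=re-er$. A $K$-linear map $e\colon U\to V$ is called a $K$-linear $R$-differential operator if for every $r\in R$ there exists an integer $n\ge0$ (depending on $r$) such that $(\theta_r)^{n+1}(e)=0$. The same definition with $S$ in place of $R$ (using the composition $K\to R\to S$) gives $K$-linear $S$-differential operators between $S$-modules. For an $R$-module $U$, $\mathrm{Hom}_R(S,U)$ is an $S$-module via $(sg)(t)=g(st)$. A flat epimorphism of commutative rings $R\to S$ is an epimorphism in the category of commutative rings such that $S$ is a flat $R$-module. *)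

(* Defs.v *)
From HB Require Import structures.
From mathcomp Require Import all_boot all_algebra.
From mathcomp Require Import boolp.

Set Implicit Arguments.
Unset Strict Implicit.
Unset Printing Implicit Defensive.

Import GRing.Theory.
Local Open Scope ring_scope.
Local Open Scope quotient_scope.

(* Commutative rings are [comPzRingType]s, so that the zero ring is allowed. *)

(* U as a K-module through f. *)
Definition restrict (K R : pzRingType) (f : {rmorphism K -> R})
  (U : lmodType R) : Type := U.

Section RestrictInstances.
Variables (K R : pzRingType) (f : {rmorphism K -> R}) (U : lmodType R).

HB.instance Definition _ := GRing.Zmodule.on (restrict f U).

Definition restrict_scale (k : K) (u : restrict f U) : restrict f U :=
  f k *: (u : U).

Fact restrict_scaleA a b u :
  restrict_scale a (restrict_scale b u) = restrict_scale (a * b) u.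
Proof. by rewrite /restrict_scale scalerA rmorphM. Qed.

Fact restrict_scale1 : left_id 1 restrict_scale.
Proof. by move=> u; rewrite /restrict_scale rmorph1 scale1r. Qed.

Fact restrict_scaleDr : right_distributive restrict_scale +%R.
Proof. by move=> a u v; rewrite /restrict_scale scalerDr. Qed.

Fact restrict_scaleDl u : {morph restrict_scale^~ u : a b / a + b}.
Proof. by move=> a b; rewrite /restrict_scale rmorphD scalerDl. Qed.

HB.instance Definition _ := GRing.Zmodule_isLmodule.Build K (restrict f U)
  restrict_scaleA restrict_scale1 restrict_scaleDr restrict_scaleDl.

End RestrictInstances.

Definition theta (R : pzRingType) (U V : lmodType R) (r : R) (e : U -> V) :
  U -> V := fun u => r *: e u - e (r *: u).

Definition is_diff_op (K R : pzRingType) (f : {rmorphism K -> R})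
    (U V : lmodType R) (e : U -> V) : Prop :=
  linear (e : restrict f U -> restrict f V) /\
  forall r : R, exists n : nat, forall u : U, iter n.+1 (theta r) e u = 0.

(* Hom_R(S, U), as an S-module by (s h)(t) = h(s t). *)
Definition coind (R S : comPzRingType) (g : {rmorphism R -> S})
  (U : lmodType R) : Type := {linear restrict g S^o -> U}.

Identity Coercion coind_to_linear : coind >-> GRing.Linear.type.

Section CoindInstances.
Variables (R S : comPzRingType) (g : {rmorphism R -> S}) (U : lmodType R).
Local Notation H := (coind g U).
Implicit Types (h : H) (s t : S).

Lemma coind_ext h1 h2 : (h1 : S -> U) =1 h2 -> h1 = h2.
Proof.
case: h1 h2 => [f1 [[a1] [b1]]] [f2 [[a2] [b2]]] /= /funext e.
by subst f2; rewrite (Prop_irrelevance a1 a2) (Prop_irrelevance b1 b2).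
Qed.

HB.instance Definition _ := gen_eqMixin H.
HB.instance Definition _ := gen_choiceMixin H.

Definition coind_zero : H := (\0 : restrict g S^o -> U).
Definition coind_opp h : H := \- h.
Definition coind_add h1 h2 : H := h1 \+ h2.

Fact coind_addA : associative coind_add.
Proof. by move=> x y z; apply: coind_ext => s /=; rewrite addrA. Qed.
Fact coind_addC : commutative coind_add.
Proof. by move=> x y; apply: coind_ext => s /=; rewrite addrC. Qed.
Fact coind_add0 : left_id coind_zero coind_add.
Proof. by move=> x; apply: coind_ext => s /=; rewrite add0r. Qed.
Fact coind_addN : left_inverse coind_zero coind_opp coind_add.
Proof. by move=> x; apply: coind_ext => s /=; rewrite addNr. Qed.

HB.instance Definition _ :=
  GRing.isZmodule.Build H coind_addA coind_addC coind_add0 coind_addN.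

Definition coind_scale_fun s h : restrict g S^o -> U :=
  fun t => h (s * (t : S) : S).

Fact coind_scale_linear s h : linear (coind_scale_fun s h).
Proof.
move=> r t t'; rewrite /coind_scale_fun -linearP; congr (h _).
by rewrite mulrDr mulrCA.
Qed.

HB.instance Definition _ s h := GRing.isLinear.Build R (restrict g S^o) U _
  (coind_scale_fun s h) (coind_scale_linear s h).

Definition coind_scale s h : H := coind_scale_fun s h.

Fact coind_scaleA s t h : coind_scale s (coind_scale t h) = coind_scale (s * t) h.
Proof.
by apply: coind_ext => x /=; rewrite /coind_scale_fun /= mulrA (mulrC t).
Qed.
Fact coind_scale1 : left_id 1 coind_scale.
Proof. by move=> h; apply: coind_ext => x /=; rewrite /coind_scale_fun mul1r. Qed.
Fact coind_scaleDr : right_distributive coind_scale +%R.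
Proof. by move=> s x y; apply: coind_ext. Qed.
Fact coind_scaleDl h : {morph coind_scale^~ h : a b / a + b}.
Proof.
move=> a b; apply: coind_ext => x /=.
by rewrite /coind_scale_fun mulrDl linearD.
Qed.

HB.instance Definition _ := GRing.Zmodule_isLmodule.Build S H
  coind_scaleA coind_scale1 coind_scaleDr coind_scaleDl.

Lemma coind_scaleE s h t : (s *: h) t = h (s * t : S).
Proof. by []. Qed.

Definition coind_eval1 h : U := h (1 : S).

End CoindInstances.

Arguments coind_eval1 {R S} g U h.

(* M (x)_R N is the quotient of the formal finite sums of pairs, written as sequences,
   by the congruence generated by the tensor relations. *)
Section Tensor.
Variables (R : comPzRingType) (M N : lmodType R).
Implicit Types (s t : seq (M * N)).

Inductive tensor_rel : seq (M * N) -> seq (M * N) -> Prop :=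
| TensorRefl s : tensor_rel s s
| TensorSym s t : tensor_rel s t -> tensor_rel t s
| TensorTrans s1 s2 s3 :
    tensor_rel s1 s2 -> tensor_rel s2 s3 -> tensor_rel s1 s3
| TensorCat s1 t1 s2 t2 :
    tensor_rel s1 t1 -> tensor_rel s2 t2 -> tensor_rel (s1 ++ s2) (t1 ++ t2)
| TensorComm s t : tensor_rel (s ++ t) (t ++ s)
| TensorZero n : tensor_rel [:: (0, n)] [::]
| TensorAddl m m' n : tensor_rel [:: (m + m', n)] [:: (m, n); (m', n)]
| TensorAddr m n n' : tensor_rel [:: (m, n + n')] [:: (m, n); (m, n')]
| TensorScale r m n : tensor_rel [:: (r *: m, n)] [:: (m, r *: n)].

Definition tensor_relb s t : bool := `[< tensor_rel s t >].

Fact tensor_relb_refl : reflexive tensor_relb.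
Proof. by move=> s; apply/asboolP; apply: TensorRefl. Qed.
Fact tensor_relb_sym : symmetric tensor_relb.
Proof. by move=> s t; apply/asboolP/asboolP; apply: TensorSym. Qed.
Fact tensor_relb_trans : transitive tensor_relb.
Proof.
move=> s2 s1 s3 /asboolP s12 /asboolP s23; apply/asboolP.
exact: TensorTrans s12 s23.
Qed.

Canonical tensor_equiv :=
  EquivRel tensor_relb tensor_relb_refl tensor_relb_sym tensor_relb_trans.

Definition tensor : Type := {eq_quot tensor_equiv}.

HB.instance Definition _ := Choice.on tensor.

Definition tensor_class s : tensor := \pi_{eq_quot tensor_equiv} s.
Definition tensor_repr (x : tensor) : seq (M * N) :=
  repr (x : {eq_quot tensor_equiv}).

Lemma tensor_reprK : cancel tensor_repr tensor_class.
Proof. exact: reprK. Qed.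

Lemma tensor_classP s t : tensor_class s = tensor_class t <-> tensor_rel s t.
Proof.
have st := @eqmodP _ tensor_equiv s t.
by split=> [/(introT st)/asboolP | H] //; apply: (elimT st); apply/asboolP.
Qed.

Lemma tensor_class_repr s : tensor_rel (tensor_repr (tensor_class s)) s.
Proof. by apply/tensor_classP; rewrite tensor_reprK. Qed.

Lemma tensorW (P : tensor -> Prop) :
  (forall s, P (tensor_class s)) -> forall x, P x.
Proof. by move=> Ps x; rewrite -[x]tensor_reprK. Qed.

Definition tmul (m : M) (n : N) : tensor := tensor_class [:: (m, n)].

Definition mapl (phi : M -> M) s := [seq (phi p.1, p.2) | p <- s].

Lemma tensor_rel_mapl (phi : M -> M) s t :
    {morph phi : x y / x + y} -> scalable phi ->
  tensor_rel s t -> tensor_rel (mapl phi s) (mapl phi t).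
Proof.
move=> phiD phiZ.
have phi0 : phi 0 = 0 by rewrite -[X in phi X](scale0r (0 : M)) phiZ scale0r.
elim=> [u|u v _|s1 s2 s3 _ H1 _|s1 t1 s2 t2 _ H1 _|u v|n|m m' n|m n n'|r m n];
  rewrite /mapl ?map_cat /= ?phi0 ?phiD ?phiZ.
- exact: TensorRefl.
- exact: TensorSym.
- exact: TensorTrans.
- exact: TensorCat.
- exact: TensorComm.
- exact: TensorZero.
- exact: TensorAddl.
- exact: TensorAddr.
- exact: TensorScale.
Qed.

Definition tensor_zero : tensor := tensor_class [::].
Definition tensor_add (x y : tensor) : tensor :=
  tensor_class (tensor_repr x ++ tensor_repr y).
Definition tensor_opp (x : tensor) : tensor :=
  tensor_class (mapl -%R (tensor_repr x)).
Definition tensor_scale (r : R) (x : tensor) : tensor :=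
  tensor_class (mapl ( *:%R r) (tensor_repr x)).

Lemma tensor_class_cat s t :
  tensor_class (s ++ t) = tensor_add (tensor_class s) (tensor_class t).
Proof.
by apply/tensor_classP/TensorSym/TensorCat; apply: tensor_class_repr.
Qed.

Lemma tensor_class_opp s :
  tensor_opp (tensor_class s) = tensor_class (mapl -%R s).
Proof.
apply/tensor_classP/tensor_rel_mapl; last exact: tensor_class_repr.
  exact: opprD.
by move=> r m; rewrite scalerN.
Qed.

Lemma tensor_class_scale r s :
  tensor_scale r (tensor_class s) = tensor_class (mapl ( *:%R r) s).
Proof.
apply/tensor_classP/tensor_rel_mapl; last exact: tensor_class_repr.
  exact: scalerDr.
by move=> a m; rewrite !scalerA mulrC.
Qed.

Fact tensor_addA : associative tensor_add.
Proof.
elim/tensorW=> s; elim/tensorW=> t; elim/tensorW=> u.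
by rewrite -!tensor_class_cat catA.
Qed.

Fact tensor_addC : commutative tensor_add.
Proof.
elim/tensorW=> s; elim/tensorW=> t; rewrite -!tensor_class_cat.
by apply/tensor_classP/TensorComm.
Qed.

Fact tensor_add0 : left_id tensor_zero tensor_add.
Proof. by elim/tensorW=> s; rewrite -tensor_class_cat. Qed.

Fact tensor_class_tmulDl m m' n :
  tmul (m + m') n = tensor_add (tmul m n) (tmul m' n).
Proof. by rewrite -tensor_class_cat; apply/tensor_classP/TensorAddl. Qed.

Fact tensor_addN : left_inverse tensor_zero tensor_opp tensor_add.
Proof.
elim/tensorW=> s; rewrite tensor_class_opp.
elim: s => [|[m n] s IHs]; first by rewrite -tensor_class_cat.
rewrite /= -(cat1s (- m, n)) -(cat1s (m, n)) !tensor_class_cat -!/(tmul _ _).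
have addACA a b c d : tensor_add (tensor_add a b) (tensor_add c d)
    = tensor_add (tensor_add a c) (tensor_add b d).
  by rewrite -!tensor_addA [tensor_add b _]tensor_addC -tensor_addA
    (tensor_addC d).
rewrite addACA IHs tensor_addC tensor_add0 -tensor_class_tmulDl addNr.
by apply/tensor_classP/TensorZero.
Qed.

HB.instance Definition _ :=
  GRing.isZmodule.Build tensor tensor_addA tensor_addC tensor_add0 tensor_addN.

Fact tensor_scaleA a b x :
  tensor_scale a (tensor_scale b x) = tensor_scale (a * b) x.
Proof.
elim/tensorW: x => s; rewrite !tensor_class_scale /mapl -map_comp.
by congr tensor_class; apply: eq_map => p /=; rewrite scalerA.
Qed.

Fact tensor_scale1 : left_id 1 tensor_scale.
Proof.
elim/tensorW=> s; rewrite tensor_class_scale /mapl.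
by rewrite (eq_map (_ : _ =1 id)) ?map_id // => -[m n] /=; rewrite scale1r.
Qed.

Fact tensor_scaleDr : right_distributive tensor_scale +%R.
Proof.
move=> r; elim/tensorW=> s; elim/tensorW=> t.
rewrite -[_ + _]tensor_class_cat !tensor_class_scale.
by rewrite -[_ + _]tensor_class_cat /mapl map_cat.
Qed.

Fact tensor_scaleDl x : {morph tensor_scale^~ x : a b / a + b}.
Proof.
move=> a b; elim/tensorW: x => s; rewrite !tensor_class_scale.
elim: s => [|[m n] s IHs] /=; first by rewrite addr0.
rewrite -cat1s -(cat1s (a *: m, n)) -(cat1s (b *: m, n)).
rewrite !tensor_class_cat -!/(tmul _ _) -!/(_ + _) IHs scalerDl.
rewrite tensor_class_tmulDl -/(_ + _).
exact: addrACA.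
Qed.

HB.instance Definition _ := GRing.Zmodule_isLmodule.Build R tensor
  tensor_scaleA tensor_scale1 tensor_scaleDr tensor_scaleDl.

Lemma tmulDl m m' n : tmul (m + m') n = tmul m n + tmul m' n.
Proof. exact: tensor_class_tmulDl. Qed.

Lemma tmulDr m n n' : tmul m (n + n') = tmul m n + tmul m n'.
Proof.
by rewrite -[_ + tmul _ _]tensor_class_cat; apply/tensor_classP/TensorAddr.
Qed.

Lemma tmulZl r m n : tmul (r *: m) n = r *: tmul m n.
Proof. by rewrite [RHS]tensor_class_scale. Qed.

Lemma tmulZr r m n : tmul m (r *: n) = r *: tmul m n.
Proof. by rewrite -tmulZl; apply/tensor_classP/TensorSym/TensorScale. Qed.

Lemma tensor_classE s : tensor_class s = \sum_(p <- s) tmul p.1 p.2.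
Proof.
elim: s => [|[m n] s IHs]; first by rewrite big_nil.
by rewrite -cat1s tensor_class_cat IHs big_cons.
Qed.

Definition bilinear_map (P : lmodType R) (b : M -> N -> P) : Prop :=
  (forall n, linear (b^~ n)) /\ (forall m, linear (b m)).

(* Independent of the representative only when b is bilinear. *)
Definition tensor_lift (P : lmodType R) (b : M -> N -> P) (x : tensor) : P :=
  \sum_(p <- tensor_repr x) b p.1 p.2.

Lemma tensor_lift_class (P : lmodType R) (b : M -> N -> P) s :
  bilinear_map b -> tensor_lift b (tensor_class s) = \sum_(p <- s) b p.1 p.2.
Proof.
move=> [bl br]; rewrite /tensor_lift.
have Dl n := (GRing.semilinear_linear (bl n)).2.
have Dr m := (GRing.semilinear_linear (br m)).2.
have Zl n : scalable (b^~ n) := (GRing.semilinear_linear (bl n)).1.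
have Zr m : scalable (b m) := (GRing.semilinear_linear (br m)).1.
suff rel_sum u v : tensor_rel u v ->
    \sum_(p <- u) b p.1 p.2 = \sum_(p <- v) b p.1 p.2.
  exact/rel_sum/tensor_class_repr.
elim=>
  [//|//|s1 s2 s3 _ -> _ -> //|s1 t1 s2 t2 _ H1 _ H2|s1 s2|n|m m' n|m n n'|r m n].
- by rewrite !big_cat /= H1 H2.
- by rewrite !big_cat /= addrC.
- by rewrite big_seq1 big_nil -[X in b X](scale0r (0 : M)) /= (Zl n) scale0r.
- by rewrite !big_cons !big_nil /= !addr0 (Dl n).
- by rewrite !big_cons !big_nil /= !addr0 (Dr m).
- by rewrite !big_seq1 /= (Zl n) (Zr m).
Qed.

Lemma tensor_lift_linear (P : lmodType R) (b : M -> N -> P) :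
  bilinear_map b -> linear (tensor_lift b).
Proof.
move=> bb r; elim/tensorW=> s; elim/tensorW=> t.
rewrite -[_ *: _]/(tensor_scale _ _) tensor_class_scale.
rewrite -[_ + _]tensor_class_cat !tensor_lift_class // big_cat /=; congr (_ + _).
rewrite big_map scaler_sumr; apply: eq_bigr => p _ /=.
exact: (GRing.semilinear_linear (bb.1 p.2)).1.
Qed.

Lemma tensor_lift_tmul (P : lmodType R) (b : M -> N -> P) m n :
  bilinear_map b -> tensor_lift b (tmul m n) = b m n.
Proof. by move=> bb; rewrite tensor_lift_class // big_seq1. Qed.

Lemma tensor_lift_unique (P : lmodType R) (b : M -> N -> P)
    (u : {linear tensor -> P}) :
  bilinear_map b -> (forall m n, u (tmul m n) = b m n) -> u =1 tensor_lift b.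
Proof.
move=> bb ub; elim/tensorW=> s; rewrite tensor_lift_class // tensor_classE.
by rewrite linear_sum; apply: eq_bigr => p _.
Qed.

End Tensor.

Definition tensor_map (R : comPzRingType) (M M' N N' : lmodType R)
    (i : {linear M -> M'}) (j : {linear N -> N'}) : tensor M N -> tensor M' N' :=
  tensor_lift (fun m n => tmul (i m) (j n)).

Lemma tensor_map_bilinear (R : comPzRingType) (M M' N N' : lmodType R)
    (i : {linear M -> M'}) (j : {linear N -> N'}) :
  bilinear_map (fun m n => tmul (i m) (j n)).
Proof.
split=> [n|m] r x y; first by rewrite linearP tmulDl tmulZl.
by rewrite linearP tmulDr tmulZr.
Qed.

Lemma tensor_map_tmul (R : comPzRingType) (M M' N N' : lmodType R)
    (i : {linear M -> M'}) (j : {linear N -> N'}) m n :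
  tensor_map i j (tmul m n) = tmul (i m) (j n).
Proof. exact/tensor_lift_tmul/tensor_map_bilinear. Qed.

Lemma tensor_map_linear (R : comPzRingType) (M M' N N' : lmodType R)
    (i : {linear M -> M'}) (j : {linear N -> N'}) : linear (tensor_map i j).
Proof. exact/tensor_lift_linear/tensor_map_bilinear. Qed.

Definition flat (R : comPzRingType) (F : lmodType R) : Prop :=
  forall (M N : lmodType R) (i : {linear M -> N}), injective i ->
  injective (tensor_map (idfun : {linear F -> F}) i).

Definition ring_epi (R S : comPzRingType) (g : {rmorphism R -> S}) : Prop :=
  forall (T : comPzRingType) (h1 h2 : {rmorphism S -> T}),
  h1 \o g =1 h2 \o g -> h1 =1 h2.

Definition flat_epi (R S : comPzRingType) (g : {rmorphism R -> S}) : Prop :=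
  ring_epi g /\ flat (restrict g S^o).

(* Main.v *)
(* Write W for Hom_R(S, U), and let M be the S-module (by precomposition) of
   K-linear R-differential operators e : W -> V, on which R also acts by
   postcomposition. For s in S, flatness and S (x)_R S = S show that the ideal
   {r | g r * s in g R} generates the unit ideal of S, and so does the
   annihilator of every element of ker g. On M the two actions of r in R differ
   by a locally nilpotent operator, so these ideals also behave like the unit
   ideal for the left action. Hence the left action of R extends uniquely to S
   (for e in M and s in S there is a unique e' with r e' = a e whenever
   g r * s = g a), and it still differs from the right one by locally nilpotent
   operators. Then D_S h s is (s (D_R o p_U)) h. *)
Require Import Defs.
From HB Require Import structures.
From mathcomp Require Import all_boot all_algebra.
From mathcomp Require Import boolp.

Set Implicit Arguments.
Unset Strict Implicit.
Unset Printing Implicit Defensive.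

Import GRing.Theory.
Local Open Scope ring_scope.

(** * Ideals of [S] generated by the image of a subset of [R] *)

Inductive ideal_ext (R S : comPzRingType) (g : R -> S) (J : R -> Prop) :
    S -> Prop :=
| IdealExt0 : ideal_ext g J 0
| IdealExtD r t z : J r -> ideal_ext g J z -> ideal_ext g J (g r * t + z).

Section IdealExt.
Variables (R S : comPzRingType) (g : R -> S) (J : R -> Prop).

Lemma ideal_ext_add x y :
  ideal_ext g J x -> ideal_ext g J y -> ideal_ext g J (x + y).
Proof.
move=> Jx Jy; elim: Jx => [|r t z Jr _ IH]; first by rewrite add0r.
by rewrite -addrA; apply: IdealExtD.
Qed.

Lemma ideal_ext_mul x y : ideal_ext g J y -> ideal_ext g J (x * y).
Proof.
elim=> [|r t z Jr _ IH]; first by rewrite mulr0; apply: IdealExt0.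
by rewrite mulrDr mulrCA; apply: IdealExtD.
Qed.

Lemma ideal_ext_opp x : ideal_ext g J x -> ideal_ext g J (- x).
Proof. by rewrite -mulN1r; apply: ideal_ext_mul. Qed.

Lemma ideal_ext_gen r : J r -> ideal_ext g J (g r).
Proof.
by move=> Jr; rewrite -[g r]mulr1 -[_ * 1]addr0; apply/IdealExtD/IdealExt0.
Qed.

End IdealExt.

(* Binomial theorem for commuting operators that are nilpotent modulo [P]. *)
Lemma iter_add_mem (M : zmodType) (P : M -> Prop) (p q : M -> M) m n e :
  (forall x y, P x -> P y -> P (x + y)) ->
  (forall x, P x -> P (p x)) -> (forall x, P x -> P (q x)) ->
  {morph p : x y / x + y} -> {morph q : x y / x + y} ->
  (forall x, p (q x) = q (p x)) ->
  P (iter m p e) -> P (iter n q e) ->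
  P (iter (m + n) (fun x => p x + q x) e).
Proof.
move=> PD Pp Pq pD qD pq.
have Ps k x : P x -> P (iter k (fun x => p x + q x) x).
  by move=> Px; elim: k => //= k IH; apply: PD; auto.
have sD k x y : iter k (fun x => p x + q x) (x + y) =
    iter k (fun x => p x + q x) x + iter k (fun x => p x + q x) y.
  by elim: k => //= k ->; rewrite pD qD addrACA.
have itC (u v : M -> M) k x : (forall x, u (v x) = v (u x)) ->
    iter k u (v x) = v (iter k u x).
  by move=> uv; elim: k => //= k ->.
(* Induction on [m + n], without binomial coefficients: one application of [p + q] replaces [e] by
   [p e] and [q e], each of which lowers one exponent by one. When an exponent is 0, the hypothesis
   is [P e] and [Ps] applies. *)
have [k le_k] := ubnP (m + n); elim: k => // k IH in m n e le_k *.
case: m n le_k => [|m] [|n] le_k Pm Pn; try exact: Ps.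
rewrite addSn iterSr sD; apply: PD.
  apply: IH => //; first by rewrite -iterSr.
  by rewrite itC //; apply: Pp.
rewrite addnS -addSn; apply: IH => //; last by rewrite -iterSr.
  by rewrite addSn -addnS.
by rewrite itC //; apply: Pq.
Qed.

(** * Extending a nilpotently twisted action *)

Section Extension.
Variables (R S : comPzRingType) (g : {rmorphism R -> S}) (M : lmodType S).
(** In the application [M] consists of differential operators, [S] acts on them by precomposition
    and [L] is postcomposition with the action of [R] on the target. *)
Variable L : R -> M -> M.
Hypothesis LDr : forall r, {morph L r : x y / x + y}.
Hypothesis LDl : forall x, {morph L^~ x : a b / a + b}.
Hypothesis LM : forall a b x, L (a * b) x = L a (L b x).
Hypothesis LZ : forall r s x, L r (s *: x) = s *: L r x.
Hypothesis Lnil : forall r x, exists n,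
  iter n (fun y => L r y - g r *: y) x = 0.

Hypothesis ann_ext : forall r, g r = 0 -> ideal_ext g (fun b => b * r = 0) 1.
Hypothesis colon_ext : forall s,
  ideal_ext g (fun r => exists a, g r * s = g a) 1.

Let L0r r : L r 0 = 0.
Proof. by apply: (addrI (L r 0)); rewrite -LDr !addr0. Qed.

Let LNr r x : L r (- x) = - L r x.
Proof. by apply: (addrI (L r x)); rewrite -LDr !addrN L0r. Qed.

Let LBr r x y : L r (x - y) = L r x - L r y.
Proof. by rewrite LDr LNr. Qed.

Let LC a b x : L a (L b x) = L b (L a x).
Proof. by rewrite -!LM mulrC. Qed.

(* Modulo [P] the elements of [J] act nilpotently from the left, hence also
   from the right, where they generate the unit ideal. *)
Lemma local_mem (P : M -> Prop) (J : R -> Prop) e :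
  P 0 -> (forall x y, P x -> P y -> P (x + y)) ->
  (forall r x, P x -> P (L r x)) -> (forall s x, P x -> P (s *: x)) ->
  ideal_ext g J 1 -> (forall r, J r -> exists n, P (iter n (L r) e)) -> P e.
Proof.
move=> P0 PD PL PZ J1 Je.
have PN x : P x -> P (- x) by rewrite -scaleN1r; apply: PZ.
(* Every element of the generated ideal acts on [e] nilpotently modulo [P], as shown by induction on
   its expression as a sum; for the element 1 this is [P e]. *)
suff [n] : exists n, P (iter n ( *:%R 1) e).
  by elim: n => //= n; rewrite scale1r.
elim: J1 => [|r t z Jr _ [n Pn]].
  by exists 1; rewrite /= scale0r.
have [m Pm] := Je r Jr.
have [k Pk] := Lnil r e.
exists (m + k + n)%N.
under [X in P X]eq_iter => y do rewrite scalerDl.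
apply: iter_add_mem => //; try by [apply: PZ | exact: scalerDr].
  by move=> x; rewrite !scalerA mulrC.
suff Pg : P (iter (m + k) ( *:%R (g r)) e).
  have -> : iter (m + k) ( *:%R (g r * t)) e
      = t ^+ (m + k) *: iter (m + k) ( *:%R (g r)) e.
    elim: (m + k)%N => [|j IH] /=; first by rewrite scale1r.
    by rewrite IH !scalerA exprS -mulrA mulrC.
  exact: PZ.
have iterN j : iter j (fun y => - (L r y - g r *: y)) e
    = (-1) ^+ j *: iter j (fun y => L r y - g r *: y) e.
  elim: j => [|j IH] /=; first by rewrite scale1r.
  by rewrite IH LZ [g r *: _]scalerA mulrC -scalerA -scalerBr exprS mulN1r
    scaleNr.
(* The right action is the left action, nilpotent on [e] modulo [P], minus the twist, nilpotent on
   [e] by [Lnil]; the two commute. *)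
have E : *:%R (g r) =1 (fun y => L r y + (- (L r y - g r *: y))).
  by move=> y; rewrite opprB addrC subrK.
rewrite (eq_iter E); apply: iter_add_mem => //.
- exact: PL.
- by move=> x Px; apply/PN/PD; [apply: PL | apply/PN/PZ].
- move=> x y; rewrite -opprD LDr scalerDr; congr (- _).
  by rewrite opprD addrACA.
- by move=> x; rewrite LNr LBr LZ.
by rewrite iterN Pk scaler0.
Qed.

(** The case [P = {0}] of [local_mem], applied to [x - y]. *)
Lemma local_eq (J : R -> Prop) x y :
  ideal_ext g J 1 -> (forall r, J r -> L r x = L r y) -> x = y.
Proof.
move=> J1 Jxy; apply/subr0_eq.
apply: (local_mem (P := fun z => z = 0) (J := J)) => //.
- by move=> u v -> ->; rewrite addr0.
- by move=> r u ->.
- by move=> s u ->; rewrite scaler0.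
by move=> r Jr; exists 1; rewrite /= LBr Jxy // subrr.
Qed.

(** The two sides agree after acting by any [r] with [r (a - b) = 0], and by [ann_ext] such [r]
    generate the unit ideal. *)
Lemma L_ker a b x : g a = g b -> L a x = L b x.
Proof.
move=> gab; have : g (a - b) = 0 by rewrite rmorphB gab subrr.
move=> /ann_ext J1; apply: (local_eq J1) => r rab.
rewrite -!LM; apply/eqP; rewrite -subr_eq0 -(subrK (r * b) (r * a)) -mulrBr rab.
by rewrite add0r subrr.
Qed.

(* Clearing denominators, [y] has to be [s] times [x]. *)
Definition is_ext (s : S) (x y : M) : Prop :=
  forall r a, g r * s = g a -> L r y = L a x.

Lemma is_ext_uniq s x y z : is_ext s x y -> is_ext s x z -> y = z.
Proof.
move=> xy xz; apply: (local_eq (colon_ext s)) => r [a e].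
by rewrite (xy _ _ e) (xz _ _ e).
Qed.

(** The [x] that have an extension are closed under addition and both actions, so [local_mem]
    reduces the claim to [L r x] with [g r * s = g a], for which [L a x] is the extension. *)
Lemma is_ext_exists s x : exists y, is_ext s x y.
Proof.
apply: (local_mem (P := fun x => exists y, is_ext s x y) _ _ _ _ (colon_ext s)).
- by exists 0 => r a _; rewrite !L0r.
- by move=> u v [u' eu] [v' ev]; exists (u' + v') => r a e;
    rewrite !LDr (eu _ _ e) (ev _ _ e).
- by move=> b u [u' eu]; exists (L b u') => r a e; rewrite LC (eu _ _ e) LC.
- by move=> t u [u' eu]; exists (t *: u') => r a e; rewrite !LZ (eu _ _ e).
move=> r [a e]; exists 1; exists (L a x) => r' a' e' /=.
(* [r' a] and [a' r] need not be equal in [R], but both have image [g r * g r' * s] in [S]. *)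
rewrite -!LM; apply: L_ker.
by rewrite !rmorphM -e -e' mulrCA mulrC.
Qed.

Definition ext s x : M := sval (cid (is_ext_exists s x)).

Lemma extP s x : is_ext s x (ext s x).
Proof. exact: svalP (cid (is_ext_exists s x)). Qed.

Lemma L_ext r a s x : g r * s = g a -> L r (ext s x) = L a x.
Proof. exact: extP. Qed.

Lemma extE s x y : is_ext s x y -> ext s x = y.
Proof. exact/is_ext_uniq/extP. Qed.

Lemma ext1 x : ext 1 x = x.
Proof. by apply: extE => r a; rewrite mulr1 => /L_ker. Qed.

Lemma extDr s : {morph ext s : x y / x + y}.
Proof. by move=> x y; apply: extE => r a e; rewrite !LDr !(L_ext _ e). Qed.

Lemma ext0 s : ext s 0 = 0.
Proof. by apply: extE => r a _; rewrite !L0r. Qed.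

Lemma extB s x y : ext s (x - y) = ext s x - ext s y.
Proof. by apply: extE => r a e; rewrite !LBr !(L_ext _ e). Qed.

Lemma ext_L s r x : ext s (L r x) = L r (ext s x).
Proof. by apply: extE => b a e; rewrite LC (L_ext _ e) LC. Qed.

Lemma extZ s t x : ext s (t *: x) = t *: ext s x.
Proof. by apply: extE => r a e; rewrite !LZ (L_ext _ e). Qed.

(** Acting by [r] and then [r'] clears the denominators of [s] and [t]. It is this linearity that
    makes [s |-> ext s e h] an element of [Hom_R(S, V)]. *)
Lemma ext_linear b s t x : ext (g b * s + t) x = L b (ext s x) + ext t x.
Proof.
apply: (local_eq (colon_ext s)) => r [a e].
apply: (local_eq (colon_ext t)) => r' [a' e'].
rewrite !LDr (LC r b) (L_ext _ e) (LC r' r (ext t x)) (L_ext _ e').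
rewrite -!LM -LDl; apply: L_ext.
rewrite rmorphD !rmorphM -e -e' mulrDr; congr (_ + _); first exact: mulrACA.
by rewrite -mulrA mulrCA.
Qed.

Lemma extM s t x : ext (s * t) x = ext s (ext t x).
Proof.
apply: (local_eq (colon_ext s)) => r [a e].
apply: (local_eq (colon_ext t)) => r' [a' e'].
rewrite (L_ext _ e) (LC r' a) (L_ext _ e') -!LM; apply: L_ext.
by rewrite !rmorphM -e -e' [g r' * g r]mulrC mulrACA.
Qed.

(* For [g r * s = g a], [r] times [ext s - s] is
   [(L a - g a) - s (L r - g r)], a sum of commuting nilpotent operators. *)
Lemma ext_nil s x : exists n, iter n (fun y => ext s y - s *: y) x = 0.
Proof.
pose d y := ext s y - s *: y.
have dD : {morph d : y z / y + z}.
  by move=> y z; rewrite /d extDr scalerDr opprD addrACA.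
have d0 : d 0 = 0 by apply: (addrI (d 0)); rewrite -dD !addr0.
have dL r y : d (L r y) = L r (d y) by rewrite /d ext_L LBr LZ.
have dZ t y : d (t *: y) = t *: d y.
  by rewrite /d extZ scalerBr !scalerA mulrC.
have itd0 n : iter n d 0 = 0 by elim: n => //= n ->.
have itdL n r y : iter n d (L r y) = L r (iter n d y).
  by elim: n => //= n ->.
apply: (local_mem (P := fun x => exists n, iter n d x = 0)
  _ _ _ _ (colon_ext s)).
- by exists 0.
- move=> u v [m eu] [n ev]; exists (m + n)%N.
  have itdD k y z : iter k d (y + z) = iter k d y + iter k d z.
    by elim: k => //= k ->.
  by rewrite itdD {1}addnC !iterD eu ev !itd0 addr0.
- by move=> r u [n eu]; exists n; rewrite itdL eu.
- move=> t u [n eu]; exists n.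
  suff -> : iter n d (t *: u) = t *: iter n d u by rewrite eu scaler0.
  by elim: n {eu} => //= n ->.
move=> r [a e].
have dE y : L r (d y) = (L a y - g a *: y) - s *: (L r y - g r *: y).
  rewrite /d LBr LZ (L_ext _ e) scalerBr opprB scalerA [s * _]mulrC e.
  by rewrite addrA subrK.
have [m nila] := Lnil a x; have [n nilr] := Lnil r x.
(* The first number is the power of [L r] that [local_mem] asks for, the second the power of [d].
   Since [d] and [L r] commute, they combine into a power of the composite computed in [dE]. *)
exists (m + n)%N; exists (m + n)%N.
have -> : iter (m + n) d (iter (m + n) (L r) x)
    = iter (m + n) (fun y => L r (d y)) x.
  by elim: (m + n)%N => //= k IH; rewrite -IH itdL dL.
rewrite (eq_iter dE).
pose th b y := L b y - g b *: y.
have thD b : {morph th b : y z / y + z}.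
  by move=> y z; rewrite /th LDr scalerDr opprD addrACA.
have th0 b : th b 0 = 0 by rewrite /th L0r scaler0 subrr.
have thN b y : th b (- y) = - th b y by rewrite /th LNr scalerN opprD.
have thZ b t y : th b (t *: y) = t *: th b y.
  by rewrite /th LZ scalerBr !scalerA mulrC.
have thL b c y : th b (L c y) = L c (th b y) by rewrite /th LBr LZ LC.
have thC b c y : th b (th c y) = th c (th b y).
  by rewrite -[th c y]/(L c y - g c *: y) thD thN thZ thL.
apply: (iter_add_mem (P := fun z => z = 0)
    (p := th a) (q := fun y => - (s *: th r y))) => //.
- by move=> u v -> ->; rewrite addr0.
- by move=> u ->.
- by move=> u ->; rewrite th0 scaler0 oppr0.
- by move=> u v; rewrite thD scalerDr opprD.
- by move=> u; rewrite thN thZ thC.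
have -> : iter n (fun y => - (s *: th r y)) x = (- s) ^+ n *: iter n (th r) x.
  elim: n {nilr} => [|k IH] /=; first by rewrite scale1r.
  by rewrite IH thZ scalerA -scaleNr exprS mulNr.
by rewrite nilr scaler0.
Qed.

End Extension.

(** * Flat epimorphisms *)

Section TensorRing.
Variables (R S : comPzRingType) (g : {rmorphism R -> S}).
Local Notation F := (restrict g S^o).

Definition tensor_ring : Type := tensor F F.
HB.instance Definition _ := GRing.Zmodule.on tensor_ring.
Implicit Types x y z : tensor_ring.

Definition smul (a : F) : F -> F := fun b => ((a : S) * (b : S) : S).

Fact smul_linear a : linear (smul a).
Proof.
move=> r b c; rewrite /smul mulrDr [RHS]/GRing.add /= /restrict_scale.
by rewrite /GRing.scale /= mulrCA.
Qed.
HB.instance Definition _ a :=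
  GRing.isLinear.Build R F F _ (smul a) (smul_linear a).

Fact smul_mull a b c : smul a (smul b c) = smul (smul a b) c.
Proof. exact: mulrA. Qed.

(** A pure tensor [a (x) b] acts on [y] by multiplication with [a] and [b] in the two factors; the
    universal property extends this over [x]. *)
Definition tensor_mul x y : tensor_ring :=
  tensor_lift (fun a b => tensor_map (smul a) (smul b) y) x.

Lemma tensor_mul_bilinear y :
  bilinear_map (fun a b : F => tensor_map (smul a) (smul b) y).
Proof.
have smulDl a b c : smul (a + b) c = smul a c + smul b c by exact: mulrDl.
have smulZl r a b : smul (r *: a) b = r *: smul a b by apply/esym/mulrA.
elim/tensorW: y => s; split=> c r a b; rewrite /tensor_map !tensor_lift_class;
  try exact: tensor_map_bilinear.
  rewrite scaler_sumr -big_split; apply: eq_bigr => p _ /=.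
  by rewrite smulDl smulZl tmulDl tmulZl.
rewrite scaler_sumr -big_split; apply: eq_bigr => p _ /=.
by rewrite smulDl smulZl tmulDr tmulZr.
Qed.

Lemma tensor_mul_tmul (a b c d : F) :
  tensor_mul (tmul a b) (tmul c d) = tmul (smul a c) (smul b d).
Proof.
by rewrite /tensor_mul tensor_lift_tmul ?tensor_map_tmul //;
  apply: tensor_mul_bilinear.
Qed.

Fact tensor_mulDl : left_distributive tensor_mul +%R.
Proof.
move=> x y z; rewrite -[x]scale1r.
rewrite [LHS]tensor_lift_linear; last exact: tensor_mul_bilinear.
by rewrite !scale1r.
Qed.

Fact tensor_mulDr : right_distributive tensor_mul +%R.
Proof.
move=> x y z; rewrite /tensor_mul /tensor_lift -big_split.
apply: eq_bigr => p _ /=.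
have := tensor_map_linear (smul p.1) (smul p.2) 1 y z.
by rewrite !scale1r.
Qed.

Lemma tensor_ind (P : tensor_ring -> Prop) :
  P 0 -> (forall x y, P x -> P y -> P (x + y)) ->
  (forall a b : F, P (tmul a b)) -> forall x, P x.
Proof.
move=> P0 PD Pt; elim/tensorW=> s; rewrite tensor_classE.
by elim/big_ind: _ => // p _; apply: Pt.
Qed.

Let mul0 x : tensor_mul 0 x = 0.
Proof. by apply: (addrI (tensor_mul 0 x)); rewrite -tensor_mulDl !addr0. Qed.
Let muls0 x : tensor_mul x 0 = 0.
Proof. by apply: (addrI (tensor_mul x 0)); rewrite -tensor_mulDr !addr0. Qed.

Fact tensor_mulC : commutative tensor_mul.
Proof.
elim/tensor_ind=> [|x x' IH IH'|a b] y; first by rewrite mul0 muls0.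
  by rewrite tensor_mulDl tensor_mulDr IH IH'.
elim/tensor_ind: y => [|y y' IH IH'|c d]; first by rewrite mul0 muls0.
  by rewrite tensor_mulDl tensor_mulDr IH IH'.
rewrite !tensor_mul_tmul; congr (tmul _ _); exact: mulrC.
Qed.

Fact tensor_mulA : associative tensor_mul.
Proof.
elim/tensor_ind=> [|x x' IH IH'|a b] y z; first by rewrite !mul0.
  by rewrite !tensor_mulDl IH IH'.
elim/tensor_ind: y => [|y y' IH IH'|c d]; first by rewrite !(mul0, muls0).
  by rewrite !(tensor_mulDl, tensor_mulDr) IH IH'.
elim/tensor_ind: z => [|z z' IH IH'|e f]; first by rewrite !muls0.
  by rewrite !tensor_mulDr IH IH'.
by rewrite !tensor_mul_tmul !smul_mull.
Qed.

Fact tensor_mul1 :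
  left_id (tmul ((1 : S) : F) ((1 : S) : F) : tensor_ring) tensor_mul.
Proof.
elim/tensor_ind=> [|x x' IH IH'|a b]; first by rewrite muls0.
  by rewrite tensor_mulDr IH IH'.
rewrite tensor_mul_tmul; congr (tmul _ _); exact: mul1r.
Qed.

HB.instance Definition _ := GRing.Zmodule_isComPzRing.Build tensor_ring
  tensor_mulA tensor_mulC tensor_mul1 tensor_mulDl.

Definition tensor_inl (s : S) : tensor_ring := tmul (s : F) ((1 : S) : F).
Definition tensor_inr (s : S) : tensor_ring := tmul ((1 : S) : F) (s : F).

Fact tensor_inl_additive : zmod_morphism tensor_inl.
Proof.
move=> a b; apply: (addIr (tensor_inl b)); rewrite subrK -[LHS]tmulDl.
by congr (tmul _ _); apply: subrK.
Qed.
Fact tensor_inl_multiplicative : monoid_morphism tensor_inl.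
Proof.
split=> // a b; rewrite [RHS]tensor_mul_tmul /tensor_inl.
by congr (tmul _ _); rewrite /smul mulr1.
Qed.
HB.instance Definition _ :=
  GRing.isZmodMorphism.Build S tensor_ring tensor_inl tensor_inl_additive.
HB.instance Definition _ :=
  GRing.isMonoidMorphism.Build S tensor_ring tensor_inl
    tensor_inl_multiplicative.

Fact tensor_inr_additive : zmod_morphism tensor_inr.
Proof.
move=> a b; apply: (addIr (tensor_inr b)); rewrite subrK -[LHS]tmulDr.
by congr (tmul _ _); apply: subrK.
Qed.
Fact tensor_inr_multiplicative : monoid_morphism tensor_inr.
Proof.
split=> // a b; rewrite [RHS]tensor_mul_tmul /tensor_inr.
by congr (tmul _ _); rewrite /smul mulr1.
Qed.
HB.instance Definition _ :=
  GRing.isZmodMorphism.Build S tensor_ring tensor_inr tensor_inr_additive.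
HB.instance Definition _ :=
  GRing.isMonoidMorphism.Build S tensor_ring tensor_inr
    tensor_inr_multiplicative.

(** The two inclusions of [S] into the tensor square agree on the image of [g], because elements of
    [R] move across the tensor sign, hence everywhere. *)
Lemma ring_epi_tmul (s : S) :
  ring_epi g ->
  tmul (s : F) ((1 : S) : F) = tmul ((1 : S) : F) (s : F) :> tensor F F.
Proof.
move=> epi; apply: (epi tensor_ring tensor_inl tensor_inr) => r /=.
have gr1 : g r = r *: (1 : F) by apply/esym/mulr1.
by rewrite /tensor_inl /tensor_inr gr1 tmulZl tmulZr.
Qed.

End TensorRing.

(** * Unit ideals from flatness *)

Section FlatColon.
Variables (R S : comPzRingType) (g : {rmorphism R -> S}) (X : lmodType R).
Local Notation F := (restrict g S^o).
Variables (X0 : X -> Prop) (y : X).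
Hypothesis X0D : forall u v, X0 u -> X0 v -> X0 (u + v).
Hypothesis X0Z : forall r u, X0 u -> X0 (r *: u).
Hypothesis X00 : X0 0.

(** The submodule [X0 + R y] of [X]. *)
Definition add_line : {pred X} := fun x => `[< exists a, X0 (x - a *: y) >].

Fact add_line_submod : submod_closed add_line.
Proof.
split=> [|r u v].
  by apply/asboolP; exists 0; rewrite scale0r subrr.
move=> /asboolP[a Xa] /asboolP[b Xb]; apply/asboolP; exists (r * a + b).
rewrite scalerDl opprD addrACA -scalerA -scalerBr.
by apply: X0D => //; apply: X0Z.
Qed.

HB.instance Definition _ := GRing.isSubmodClosed.Build R X add_line
  add_line_submod.

Record line_ext := LineExt { line_val :> X; _ : line_val \in add_line }.
HB.instance Definition _ := [isSub for line_val].
HB.instance Definition _ := [Choice of line_ext by <:].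
HB.instance Definition _ := [SubChoice_isSubZmodule of line_ext by <:].
HB.instance Definition _ := [SubZmodule_isSubLmodule of line_ext by <:].

Local Notation J := (fun r => X0 (r *: y)).
Local Notation JS := (ideal_ext g J).

Let coefP (n : line_ext) : exists a, X0 (val n - a *: y).
Proof. exact/asboolP/(valP n). Qed.
Let coef n : R := sval (cid (coefP n)).
Let X0_coef n : X0 (val n - coef n *: y).
Proof. exact: svalP (cid (coefP n)). Qed.

Let X0N u : X0 u -> X0 (- u).
Proof. by rewrite -scaleN1r; apply: X0Z. Qed.

Let X0B u v : X0 u -> X0 v -> X0 (u - v).
Proof. by move=> Xu Xv; apply/X0D/X0N. Qed.

Let coef_uniq u a b : X0 (u - b *: y) -> X0 (u - a *: y) -> X0 ((b - a) *: y).
Proof.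
move=> Xb Xa; have -> : (b - a) *: y = (u - a *: y) - (u - b *: y); last first.
  exact: X0B.
by rewrite opprB [RHS]addrC subrKA scalerBl.
Qed.

(* [N -> R/J], [r y |-> r], is well defined, so [t (x) n |-> t * g (coef n)]
   is bilinear modulo [JS]; this avoids forming the quotient [S/JS]. *)
Lemma tensor_rel_coef (u v : seq (F * line_ext)) : tensor_rel u v ->
  JS (\sum_(p <- u) (p.1 : S) * g (coef p.2)
      - \sum_(p <- v) (p.1 : S) * g (coef p.2)).
Proof.
have JSJ (t : S) r : X0 (r *: y) -> JS (t * g r).
  by move=> Jr; apply/ideal_ext_mul/ideal_ext_gen.
elim=> [s|s t _ IH|s1 s2 s3 _ IH1 _ IH2|s1 t1 s2 t2 _ IH1 _ IH2|s t|n|m m' n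
  |m n n'|r m n].
- by rewrite subrr; apply: IdealExt0.
- by rewrite -opprB; apply: ideal_ext_opp.
- set a := \sum_(p <- s1) _ in IH1 *; set c := \sum_(p <- s3) _ in IH2 *.
  set b := \sum_(p <- s2) _ in IH1 IH2.
  have -> : a - c = (a - b) + (b - c) by rewrite subrKA.
  exact: ideal_ext_add.
- by rewrite !big_cat opprD addrACA; apply: ideal_ext_add.
- by rewrite !big_cat [X in X - _]addrC subrr; apply: IdealExt0.
- rewrite big_seq1 big_nil /= subr0 mul0r; exact: IdealExt0.
- rewrite !big_cons !big_nil /= !addr0 -mulrDl subrr; exact: IdealExt0.
- rewrite !big_cons !big_nil /= !addr0 -mulrDr -mulrBr -rmorphD -rmorphB.
  apply: JSJ; apply: (coef_uniq (X0_coef _)).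
  by rewrite raddfD scalerDl opprD addrACA; apply: X0D; apply: X0_coef.
rewrite !big_seq1 /=.
have -> : ((r *: m : F) : S) = m * g r by apply: mulrC.
rewrite -mulrA -mulrBr -rmorphM -rmorphB; apply: JSJ.
apply: coef_uniq (X0_coef _).
by rewrite linearZ -scalerA -scalerBr; apply/X0Z/X0_coef.
Qed.

(** By flatness the equation already holds over [N = X0 + R y] in place of [X]. There the map of
    [tensor_rel_coef] turns it into [1 = 0] modulo [JS], as the coefficient of [y] is 1 and that of
    [x0] is 0 modulo [J]. *)
Lemma flat_colon (t : F) (x0 : X) :
  flat F -> X0 x0 -> tmul ((1 : S) : F) y = tmul t x0 -> JS 1.
Proof.
move=> flatF Xx0 yx0.
have Ny : y \in add_line.
  by apply/asboolP; exists 1; rewrite scale1r subrr.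
have Nx0 : x0 \in add_line.
  by apply/asboolP; exists 0; rewrite scale0r subr0.
have /flatF inj : injective (val : {linear line_ext -> X}) by exact: val_inj.
have /tensor_classP/tensor_rel_coef :
    tmul ((1 : S) : F) (LineExt Ny) = tmul t (LineExt Nx0).
  by apply: inj; rewrite !tensor_map_tmul.
rewrite !big_seq1 mul1r.
have := X0_coef (LineExt Ny); have := X0_coef (LineExt Nx0).
set c := coef (LineExt Ny); set c0 := coef _ => Xc0 Xc /= H.
have Jc0 : J c0 by rewrite -(subKr x0 (c0 *: y)); apply: X0B.
have Jc : J (1 - c) by rewrite scalerBl scale1r.
(* The chosen coefficients [c] of [y] and [c0] of [x0] are only known modulo [J], so the terms
   [1 - c] and [c0] are accounted for separately. *)
have -> : 1 = g (1 - c) + ((g c - t * g c0) + t * g c0).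
  by rewrite subrK rmorphB rmorph1 subrK.
apply: ideal_ext_add; first exact: ideal_ext_gen.
by apply: ideal_ext_add => //; apply/ideal_ext_mul/ideal_ext_gen.
Qed.

End FlatColon.

Lemma tmul0l (R : comPzRingType) (M N : lmodType R) (n : N) :
  tmul (0 : M) n = 0.
Proof. by rewrite -[X in tmul X](scale0r (0 : M)) tmulZl scale0r. Qed.

(** [flat_colon] with [X = R], [X0 = 0] and [y = r], since [1 (x) r = g r (x) 1 = 0]. *)
Lemma flat_ann (R S : comPzRingType) (g : {rmorphism R -> S}) r :
  flat (restrict g S^o) -> g r = 0 -> ideal_ext g (fun b => b * r = 0) 1.
Proof.
move=> flatg gr0.
apply: (@flat_colon _ _ g R^o (fun x => x = 0) r _ _ _ 0 0) => //.
- by move=> u v -> ->; rewrite addr0.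
- by move=> b u ->; rewrite scaler0.
have -> : (r : R^o) = r *: (1 : R^o) by apply/esym/mulr1.
rewrite tmulZr -tmulZl.
have -> : r *: ((1 : S) : restrict g S^o) = 0.
  by rewrite [LHS]/GRing.scale /= /restrict_scale gr0 scale0r.
by rewrite !tmul0l.
Qed.

(** [flat_colon] with [X = S], [X0 = g R] and [y = s]: the epimorphism property gives
    [1 (x) s = s (x) 1], and 1 lies in [g R]. *)
Lemma flat_epi_colon (R S : comPzRingType) (g : {rmorphism R -> S}) (s : S) :
  flat_epi g -> ideal_ext g (fun r => exists a, g r * s = g a) 1.
Proof.
move=> [epi flatg].
apply: (@flat_colon _ _ g (restrict g S^o)
  (fun x => exists a, (x : S) = g a) s _ _ _ s (1 : S)) => //.
- by move=> u v [a ->] [b ->]; exists (a + b); rewrite rmorphD.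
- by move=> r u [a ->]; exists (r * a); rewrite rmorphM.
- by exists 0; rewrite rmorph0.
- by exists 1; rewrite rmorph1.
exact/esym/ring_epi_tmul.
Qed.

(** * Modules of differential operators *)

Section DiffOpClosure.
Variables (K R : comPzRingType) (f : {rmorphism K -> R}).
Implicit Types U V : lmodType R.

Lemma iter_theta_comp U V U' V' (p : {linear U' -> U}) (q : {linear V -> V'})
    (e : U -> V) r n :
  iter n (theta r) (q \o e \o p) = q \o iter n (theta r) e \o p.
Proof.
elim: n => //= n ->; apply/funext => u.
by rewrite /theta /= linearB !linearZ.
Qed.

Lemma is_diff_op_comp U V U' V' (p : {linear U' -> U}) (q : {linear V -> V'})
    (e : U -> V) : is_diff_op f e -> is_diff_op f (q \o e \o p).
Proof.
move=> [lin nil]; split=> [k u v|r].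
  have /= -> := linearP p (f k) u v.
  have := lin k (p u) (p v); rewrite /= => ->.
  exact: (linearP q).
have [n en] := nil r; exists n => u.
by rewrite iter_theta_comp /= -/(iter n.+1 (theta r) e (p u)) en linear0.
Qed.

Lemma is_diff_op0 U V : is_diff_op f (fun _ : U => 0 : V).
Proof.
split=> [k u v|r]; first by rewrite scaler0 addr0.
by exists 0 => u; rewrite /= /theta scaler0 subr0.
Qed.

Lemma iter_thetaD U V (e1 e2 : U -> V) r n u :
  iter n (theta r) (fun u => e1 u + e2 u) u
  = iter n (theta r) e1 u + iter n (theta r) e2 u.
Proof.
elim: n u => // n IH u.
by rewrite !iterS /theta !IH scalerDr opprD addrACA.
Qed.

Lemma iter_theta_eq0 U V (e : U -> V) r m n :
  (forall u, iter n (theta r) e u = 0) ->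
  forall u, iter (m + n) (theta r) e u = 0.
Proof.
move=> en; elim: m => //= m IH u.
by rewrite /theta !IH scaler0 subr0.
Qed.

Lemma is_diff_opD U V (e1 e2 : U -> V) :
  is_diff_op f e1 -> is_diff_op f e2 -> is_diff_op f (fun u => e1 u + e2 u).
Proof.
move=> [lin1 nil1] [lin2 nil2]; split=> [k u v|r].
  have /= -> := lin1 k u v; have /= -> := lin2 k u v.
  by rewrite scalerDr addrACA.
have [m e1m] := nil1 r; have [n e2n] := nil2 r; exists (m.+1 + n)%N => u.
rewrite iter_thetaD -addnS (iter_theta_eq0 _ e2n) addr0 addnC.
exact: iter_theta_eq0.
Qed.

End DiffOpClosure.

Section DiffOpModule.
Variables (K R S : comPzRingType) (f : {rmorphism K -> R}).
Variables (g : {rmorphism R -> S}) (W : lmodType S) (V : lmodType R).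

(** The source is an [S]-module, so [S] acts by precomposition; the target is only an [R]-module, so
    postcomposition gives an action of [R] alone, the one to be extended. *)
Record diff_op := DiffOp {
  diff_op_fun :> W -> V;
  diff_opP : is_diff_op f (diff_op_fun : restrict g W -> V) }.
Implicit Types (d e : diff_op) (r : R) (s : S).

Lemma diff_op_ext d e : (d : W -> V) =1 e -> d = e.
Proof.
case: d e => [d dP] [e eP] /= /funext de.
by subst e; rewrite (Prop_irrelevance dP eP).
Qed.

HB.instance Definition _ := gen_eqMixin diff_op.
HB.instance Definition _ := gen_choiceMixin diff_op.

Definition diff_op_zero := DiffOp (is_diff_op0 f (restrict g W) V).
Definition diff_op_add d e := DiffOp (is_diff_opD (diff_opP d) (diff_opP e)).

Fact diff_op_lscale_proof r d :
  is_diff_op f ((fun w => r *: d w) : restrict g W -> V).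
Proof.
exact: (is_diff_op_comp (U' := restrict g W) idfun ( *:%R r) (diff_opP d)).
Qed.
Definition diff_op_lscale r d := DiffOp (diff_op_lscale_proof r d).

Definition restrict_mul s : restrict g W -> restrict g W :=
  fun w => s *: (w : W).
Fact restrict_mul_linear s : linear (restrict_mul s).
Proof.
rewrite /restrict_mul => r u v; rewrite -[r *: u]/(g r *: (u : W)).
by rewrite scalerDr scalerA mulrC -scalerA.
Qed.
HB.instance Definition _ s := GRing.isLinear.Build R (restrict g W)
  (restrict g W) _ (restrict_mul s) (restrict_mul_linear s).

Fact diff_op_scale_proof s d :
  is_diff_op f ((fun w => d (s *: w)) : restrict g W -> V).
Proof.
exact: (is_diff_op_comp (restrict_mul s) idfun (diff_opP d)).
Qed.
Definition diff_op_scale s d := DiffOp (diff_op_scale_proof s d).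

Lemma diff_op_linear d k (u v : W) :
  d (g (f k) *: u + v) = f k *: d u + d v.
Proof. exact: (diff_opP d).1. Qed.

Lemma diff_opD d : {morph d : u v / u + v}.
Proof.
by move=> u v; have := diff_op_linear d 1 u v; rewrite !rmorph1 !scale1r.
Qed.

Fact diff_op_addA : associative diff_op_add.
Proof. by move=> x y z; apply: diff_op_ext => w /=; rewrite addrA. Qed.
Fact diff_op_addC : commutative diff_op_add.
Proof. by move=> x y; apply: diff_op_ext => w /=; rewrite addrC. Qed.
Fact diff_op_add0 : left_id diff_op_zero diff_op_add.
Proof. by move=> x; apply: diff_op_ext => w /=; rewrite add0r. Qed.
Fact diff_op_addN :
  left_inverse diff_op_zero (diff_op_lscale (-1)) diff_op_add.
Proof.
by move=> x; apply: diff_op_ext => w /=; rewrite scaleN1r addNr.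
Qed.
HB.instance Definition _ := GRing.isZmodule.Build diff_op
  diff_op_addA diff_op_addC diff_op_add0 diff_op_addN.

Fact diff_op_scaleA s t d :
  diff_op_scale s (diff_op_scale t d) = diff_op_scale (s * t) d.
Proof. by apply: diff_op_ext => w /=; rewrite scalerA mulrC. Qed.
Fact diff_op_scale1 : left_id 1 diff_op_scale.
Proof. by move=> d; apply: diff_op_ext => w /=; rewrite scale1r. Qed.
Fact diff_op_scaleDr : right_distributive diff_op_scale +%R.
Proof. by move=> s x y; apply: diff_op_ext. Qed.
Fact diff_op_scaleDl d : {morph diff_op_scale^~ d : a b / a + b}.
Proof.
by move=> a b; apply: diff_op_ext => w /=; rewrite scalerDl diff_opD.
Qed.
HB.instance Definition _ := GRing.Zmodule_isLmodule.Build S diff_op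
  diff_op_scaleA diff_op_scale1 diff_op_scaleDr diff_op_scaleDl.

Lemma diff_op_scaleE s d w : (s *: d) w = d (s *: w).
Proof. by []. Qed.

Lemma diff_op_subE d e w : (d - e) w = d w - e w.
Proof. by rewrite -[RHS]/(d w + - e w) -scaleN1r. Qed.

Lemma lscaleDr r : {morph diff_op_lscale r : x y / x + y}.
Proof. by move=> x y; apply: diff_op_ext => w /=; rewrite scalerDr. Qed.
Lemma lscaleDl x : {morph diff_op_lscale^~ x : a b / a + b}.
Proof. by move=> a b; apply: diff_op_ext => w /=; rewrite scalerDl. Qed.
Lemma lscaleM a b x :
  diff_op_lscale (a * b) x = diff_op_lscale a (diff_op_lscale b x).
Proof. by apply: diff_op_ext => w /=; rewrite scalerA. Qed.
Lemma lscaleZ r s x : diff_op_lscale r (s *: x) = s *: diff_op_lscale r x.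
Proof. exact: diff_op_ext. Qed.
(** The operator [L r - g r] on this module is [theta r], so its local nilpotency is part of the
    definition of a differential operator. *)
Lemma lscale_nil r x :
  exists n, iter n (fun y => diff_op_lscale r y - g r *: y) x = 0.
Proof.
have [n xn] := (diff_opP x).2 r; exists n.+1; apply: diff_op_ext => w.
rewrite -[RHS](xn w); elim: {xn} n.+1 w => // k IH w.
by rewrite !iterS diff_op_subE /theta -!IH.
Qed.

End DiffOpModule.

(** * Coinduced modules and the extension of [D_R] *)

Lemma linear_coind (R S : comPzRingType) (g : {rmorphism R -> S})
    (V : lmodType R) (F : restrict g S^o -> V) :
  linear F -> {h : coind g V | (h : S -> V) =1 F}.
Proof.
move=> linF.
pose F_lin := GRing.isLinear.Build R (restrict g S^o) V _ F linF.
pose h : coind g V := HB.pack_for {linear restrict g S^o -> V} F F_lin.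
by exists h.
Qed.

Section CoindEvaluation.
Variables (R S : comPzRingType) (g : {rmorphism R -> S}) (U : lmodType R).

Lemma coind_mulZ (h : coind g U) r (s : S) : h (g r * s : S) = r *: h s.
Proof. by rewrite -linearZ. Qed.

Definition coind_eval (s : S) : restrict g (coind g U) -> U :=
  fun h => (h : coind g U) s.

Fact coind_eval_linear s : linear (coind_eval s).
Proof.
by move=> r h h'; rewrite /coind_eval -coind_mulZ.
Qed.
HB.instance Definition _ s := GRing.isLinear.Build R (restrict g (coind g U))
  U _ (coind_eval s) (coind_eval_linear s).

End CoindEvaluation.

Theorem theorem7p1 (K R S : comPzRingType)
    (f : {rmorphism K -> R}) (g : {rmorphism R -> S})
    (U V : lmodType R) (D_R : U -> V) :
  flat_epi g ->
  is_diff_op f D_R ->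
  exists! D_S : coind g U -> coind g V,
    is_diff_op (g \o f) D_S /\
    coind_eval1 g V \o D_S = D_R \o coind_eval1 g U.
Proof.
move=> epi diffD.
have ann r : g r = 0 -> _ := flat_ann epi.2.
have colon s := flat_epi_colon s epi.
pose W := coind g U.
pose L := @diff_op_lscale K R S f g W V.
pose ext := ext (L := L) (@lscaleDr _ _ _ f g W V)
  (@lscaleM _ _ _ f g W V) (@lscaleZ _ _ _ f g W V)
  (@lscale_nil _ _ _ f g W V) ann colon.
have ext_lin b s t x : ext (g b * s + t) x = L b (ext s x) + ext t x.
  exact/ext_linear/lscaleDl.
have e0P := is_diff_op_comp (@coind_eval _ _ g U 1) idfun diffD.
pose e0 : diff_op f g W V := DiffOp e0P.
(* The construction is made for every [e] and not only [e0], because [theta s] turns [phi e] into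
   [phi] of another operator. *)
have phiP (e : diff_op f g W V) (h : W) :
    {d : coind g V | (d : S -> V) =1 fun s => ext s e h}.
  apply: linear_coind => r s t.
  exact: (congr1 (fun d : diff_op f g W V => d h) (ext_lin r s t e)).
pose phi e h := sval (phiP e h).
have phiE e h s : phi e h s = ext s e h := svalP (phiP e h) s.
exists (phi e0); split=> [|D [[linD nilD] evD]].
  split; last first.
    by apply/funext => h; rewrite /= /coind_eval1 phiE /ext ext1.
  split=> [k h h'|s].
    apply: coind_ext => t.
    rewrite -[RHS]/(phi e0 h (g (f k) * t) + phi e0 h' t) coind_mulZ !phiE.
    exact: diff_op_linear.
  have [n en] : exists n, iter n (fun y => ext s y - s *: y) e0 = 0.
    exact: ext_nil.
  (* [phi] carries [ext s - s] to [theta s]: by [extM], [s] times [phi e] is [phi (ext s e)], and by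
     [extZ], precomposing [phi e] with [s] gives [phi (s *: e)]. *)
  have phi_iter m e : iter m (theta s) (phi e)
      = phi (iter m (fun y => ext s y - s *: y) e).
    elim: m => //= m ->; apply/funext => h; apply: coind_ext => t.
    set y := iter m _ e.
    rewrite phiE; transitivity (phi y h (s * t) - phi y (s *: h) t) => //.
    rewrite !phiE mulrC /ext extM.
    by rewrite -diff_op_scaleE -extZ -diff_op_subE -extB.
  have phi0 : phi 0 = fun _ => 0.
    by apply/funext => h; apply: coind_ext => t; rewrite phiE /ext ext0.
  by exists n => h; rewrite /= phi_iter en /theta phi0 scaler0 subr0.
apply/funext => h; apply: coind_ext => s; rewrite phiE.
(* For uniqueness, [h |-> D h s] is itself an [R]-differential operator: the nilpotency at [r] is
   that of [D] at [g r]. It remains to see that it satisfies the property characterising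
   [ext s e0]. *)
have DP : is_diff_op f (D : restrict g W -> restrict g (coind g V)).
  split=> [k u v|r]; first exact: linD.
  exact: nilD.
have esP := is_diff_op_comp idfun (coind_eval s) DP.
rewrite (_ : ext s e0 = DiffOp esP) //.
(* Both sides equal [D w (g a)], by [R]-linearity of [D w] and [D w 1 = D_R (w 1)]. *)
apply: extE => r a er; apply: diff_op_ext => w /=.
have ev1 : D w 1 = D_R (w 1) := congr1 (fun F => F w) evD.
by rewrite /coind_eval -ev1 -!coind_mulZ er mulr1.
Qed.
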